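(* Let $p\ge3$ be an integer and let $\epsilon\in(0,1)$. If $(\beta,h)\in\mathfrak{B}_p$, then the mixing time of the Glauber dynamics for the $p$-spin Curie-Weiss model on $N$ nodes satisfies $t_{\mathbf{mix}}(\epsilon)=\Omega(N^{4/3})$ as $N\to\infty$.
   Context: Model: $\mathcal{C}_N:=\{-1,1\}^N$; $\bar x:=\frac1N\sum_{i=1}^N x_i$. The $p$-spin Curie-Weiss measure is the probability measure on $\mathcal{C}_N$ with $\mathbb{P}_{\beta,h,p}(\boldsymbol{x})\propto\exp\{N(\beta\bar x^p+h\bar x)\}$, where $\beta>0$, $h\in\mathbb{R}$. Glauber dynamics: the Markov chain $\boldsymbol{X}^t$ on $\mathcal{C}_N$ in which, at each step, an index $i$ is chosen uniformly from $\{1,\dots,N\}$, $X_i^{t+1}$ is drawn from the distribution on $\{-1,1\}$ with mean $\tanh(p\beta(\bar X^t)^{p-1}+h)$, and all other coordinates are unchanged. Mixing time: $t_{\mathbf{mix}}(\epsilon):=\min\{t:\max_{\boldsymbol{x}\in\mathcal{C}_N}d_{\mathrm{TV}}(\mathbb{P}_{\boldsymbol{x}}(\boldsymbol{X}^t\in\cdot),\mathbb{P}_{\beta,h,p})\le\epsilon\}$ (with $\min\emptyset=\infty$). Definition of $\mathfrak{B}_p$: let $H_{\beta,h,p}(x)=\beta x^p+hx-I(x)$ on $[-1,1]$, where $I(x)=\frac12\{(1+x)\log(1+x)+(1-x)\log(1-x)\}$, and let $$\hat\beta_p=\frac{1}{2(p-1)}\left(\frac{p}{p-2}\right)^{\frac{p-2}{2}},\qquad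 \beta_p':=\sup\Big\{\beta>0:\sup_{x\in[0,1]}H'_{\beta,0,p}(x)=0\Big\}.$$ For $\beta>\hat\beta_p$, the function $H''_{\beta,0,p}$ has exactly two roots $0<a_1(\beta)<a_2(\beta)<1$ in $(0,1)$. - For odd $p$: define $U(\beta):=-H'_{\beta,0,p}(a_1(\beta))$ and $L(\beta):=-H'_{\beta,0,p}(a_2(\beta))$ for $\beta>\hat\beta_p$; $\mathfrak{B}_p$ is the union of the graphs of $U$ and $L$. - For even $p$: define $U(\beta):=-\min\{H'_{\beta,0,p}(-a_2(\beta)),H'_{\beta,0,p}(a_1(\beta))\}$ for $\beta>\hat\beta_p$ and $L(\beta):=-H'_{\beta,0,p}(a_2(\beta))$ for $\beta\in(\hat\beta_p,\beta_p']$; $\mathfrak{B}_p$ is the union of the graphs of $U,-U,L,-L$. The implied constant in $\Omega(\cdot)$ may depend on $\epsilon,\beta,h,p$ but not on $N$. *)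

(* Defs.v *)
From HB Require Import structures.
From mathcomp Require Import all_boot all_order all_algebra.
From mathcomp Require Import all_classical all_reals all_analysis.

Set Implicit Arguments.
Unset Strict Implicit.
Unset Printing Implicit Defensive.

Import Order.TTheory GRing.Theory Num.Theory.
Import numFieldNormedType.Exports.

Local Open Scope classical_set_scope.
Local Open Scope ring_scope.

(* The cube {-1,1}^N: [true] encodes the spin +1 and [false] the spin -1. *)
Definition cube (N : nat) : finType := {ffun 'I_N -> bool}.

Definition spin {R : realType} (b : bool) : R := if b then 1 else -1.

Definition magnetization (R : realType) (N : nat) (x : cube N) : R :=
  N%:R^-1 * \sum_(i < N) spin (x i).

Definition cw_weight (R : realType) (beta h : R) (p N : nat) (x : cube N) : R :=
  expR (N%:R * (beta * magnetization R x ^+ p + h * magnetization R x)).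

Definition curie_weiss (R : realType) (beta h : R) (p N : nat) (x : cube N)
    : R :=
  cw_weight beta h p x / \sum_(y : cube N) cw_weight beta h p y.

Definition tanh (R : realType) (x : R) : R :=
  (expR x - expR (- x)) / (expR x + expR (- x)).

(* [spin_law m] is the probability mass function of the distribution on
   {-1,1} with mean m. *)
Definition spin_law (R : realType) (m : R) (b : bool) : R :=
  (1 + spin b * m) / 2.

Definition set_spin (N : nat) (x : cube N) (i : 'I_N) (b : bool) : cube N :=
  [ffun j => if j == i then b else x j].

(* One-step transition probability from x to y: average over the uniform
   index i and the new spin b. As in the model, the mean of the new spin
   depends on the magnetization of the whole of x, coordinate i included. *)
Definition glauber_kernel (R : realType) (beta h : R) (p N : nat)
    (x y : cube N) : R :=
  \sum_(i < N) N%:R^-1 *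
    \sum_(b : bool)
      spin_law (tanh (p%:R * beta * magnetization R x ^+ p.-1 + h)) b *
      (y == set_spin x i b)%:R.

(* Law of X^t for the chain started at X^0 = x. *)
Fixpoint glauber_law (R : realType) (beta h : R) (p N : nat) (x : cube N)
    (t : nat) : cube N -> R :=
  if t is s.+1 then
    fun y => \sum_(z : cube N)
      glauber_law beta h p x s z * glauber_kernel beta h p z y
  else fun y => (y == x)%:R.

Definition dTV (R : realType) (T : finType) (mu nu : T -> R) : R :=
  \big[Num.max/0]_(A : {set T})
    `|\sum_(x in A) mu x - \sum_(x in A) nu x|.

(* Extended-real valued; ereal_inf set0 = +oo, and the infimum of a nonempty
   set of natural numbers is its minimum. *)
Definition mixing_time (R : realType) (beta h : R) (p N : nat) (eps : R)
    : \bar R :=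
  ereal_inf [set (t%:R)%:E | t in [set t : nat |
    \big[Num.max/0]_(x : cube N)
      dTV (glauber_law beta h p x t) (@curie_weiss R beta h p N) <= eps]].

(* Since ln 0 = 0 in the library, this is right at x = 1 and x = -1 as well. *)
Definition cw_entropy (R : realType) (x : R) : R :=
  2^-1 * ((1 + x) * ln (1 + x) + (1 - x) * ln (1 - x)).

(* The function H_{beta,h,p}; its derivatives are only used on ]-1, 1[. *)
Definition cw_H (R : realType) (beta h : R) (p : nat) (x : R) : R :=
  beta * x ^+ p + h * x - cw_entropy x.

Definition beta_hat (R : realType) (p : nat) : R :=
  (2 * (p%:R - 1))^-1 * (p%:R / (p%:R - 2)) `^ ((p%:R - 2) / 2).

(* The supremum over [0, 1] of H'_{beta,0,p} is taken over [0, 1[: as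
   H'_{beta,0,p} tends to -oo at 1, its value there is -oo. *)
Definition beta_prime (R : realType) (p : nat) : R :=
  sup [set beta : R | 0 < beta /\
    ereal_sup [set (derive1 (cw_H beta 0 p) x)%:E | x in `[0, 1[ ] = 0%E].

Definition H2_roots (R : realType) (beta : R) (p : nat) : set R :=
  [set x : R | 0 < x < 1 /\ derive1n 2 (cw_H beta 0 p) x = 0].

(* For beta > beta_hat there are exactly two roots a1 < a2, which are thus the
   infimum and the supremum of the set of roots. *)
Definition a1 (R : realType) (p : nat) (beta : R) : R := inf (H2_roots beta p).
Definition a2 (R : realType) (p : nat) (beta : R) : R := sup (H2_roots beta p).

Definition U_odd (R : realType) (p : nat) (beta : R) : R :=
  - derive1 (cw_H beta 0 p) (a1 p beta).

Definition U_even (R : realType) (p : nat) (beta : R) : R :=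
  - Num.min (derive1 (cw_H beta 0 p) (- a2 p beta))
            (derive1 (cw_H beta 0 p) (a1 p beta)).

Definition L (R : realType) (p : nat) (beta : R) : R :=
  - derive1 (cw_H beta 0 p) (a2 p beta).

Definition graph_on (R : realType) (D : set R) (f : R -> R) : set (R * R) :=
  [set z | D z.1 /\ z.2 = f z.1].

Definition frakB (R : realType) (p : nat) : set (R * R) :=
  if odd p then
    graph_on `]beta_hat R p, +oo[ (U_odd p) `|`
    graph_on `]beta_hat R p, +oo[ (L p)
  else
    graph_on `]beta_hat R p, +oo[ (U_even p) `|`
    graph_on `]beta_hat R p, +oo[ (fun beta => - U_even p beta) `|`
    graph_on `]beta_hat R p, beta_prime R p] (L p) `|`
    graph_on `]beta_hat R p, beta_prime R p] (fun beta => - L p beta).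

(* Main.v *)
Require Import Defs.
From HB Require Import structures.
From mathcomp Require Import all_boot all_order all_algebra.
From mathcomp Require Import all_classical all_reals all_analysis.
From mathcomp Require Import ring lra.

Set Implicit Arguments.
Unset Strict Implicit.
Unset Printing Implicit Defensive.

Import Order.TTheory GRing.Theory Num.Theory.
Import numFieldNormedType.Exports.

Local Open Scope classical_set_scope.
Local Open Scope ring_scope.

(** Write u(x) = p beta x^(p-1) + h for the local field.  A point (beta, h) of
    frakB comes with a magnetization m in ]-1, 1[ at which both H' and H''
    vanish.  In terms of the dynamics, tanh (u m) = m and x |-> tanh (u x) has
    slope 1 at m, so that the drift tanh (u x) - x is at most C (x - m)^2 on
    [-1, 1].

    Let s = N^(1/3), and let Y = s (xbar - m) be the rescaled magnetization.
    One step of the chain moves Y by at most 2 / s^2, and by at most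
    C Y^2 / s^4 on average.  With the bounded function psi y = y^2 / (1 + y^2),
    for which psi' y * y^2 is bounded too, one step increases the mean of psi Y
    by O(s^-4) whatever the current state ([psi_drift]).  A chain that
    starts at a configuration with magnetization next to m therefore still has
    |Y| <= d with probability close to 1 after t < c s^4 = c N^(4/3) steps
    ([glauber_law_confined]).

    The Gibbs measure gives the same window |Y| <= d a mass O(d)
    ([gibbs_window]).  When |xbar - m| = O(1/s), the total weights of
    neighbouring magnetization levels have a ratio at least 1 - O(s^-2), as the
    logarithm of the ratio is 2 H' up to O(1/N) ([level_weight_slow]).  Each
    level of the window is thus followed by about s^2 levels of comparable
    weight, and its own weight is a fraction O(s^-2) of the total; the window
    has d s^2 + O(1) levels.

    For d small, and then c small, the two masses of the window differ by more
    than eps, hence so does the total variation distance. *)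

(** * Hyperbolic tangent and second-order Taylor bounds *)

Lemma cosh_gt0 (R : realType) (u : R) : 0 < expR u + expR (- u).
Proof. by rewrite addr_gt0 ?expR_gt0. Qed.

Lemma tanh_bounds (R : realType) (u : R) : -1 < tanh u < 1.
Proof.
have u0 := expR_gt0 u; have v0 := expR_gt0 (- u).
rewrite /tanh ltr_pdivlMr ?cosh_gt0 // ltr_pdivrMr ?cosh_gt0 //.
by apply/andP; split; lra.
Qed.

(** The Gibbs weight of a level changes by a factor exp (2 u) times an
    entropy term; this identity turns that factor into the one which the
    drift bound controls. *)
Lemma expR_tanh (R : realType) (u : R) :
  expR (2 * u) = (1 + tanh u) / (1 - tanh u).
Proof.
have u0 := expR_gt0 u; have v0 := expR_gt0 (- u).
have -> : 2 * u = u - - u by ring.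
rewrite expRD [expR (- - u)]expRN /tanh.
by field; rewrite !gt_eqF //=; lra.
Qed.

(** The entropy has derivative atanh, in the form produced by
    differentiating the logarithms, so a critical point of H is a fixed
    point of tanh of the local field. *)
Lemma tanh_half_ln (R : realType) (x : R) : -1 < x < 1 ->
  tanh (2^-1 * (ln (1 + x) - ln (1 - x))) = x.
Proof.
move=> /andP[x1 x2]; set u := 2^-1 * _.
have := expR_tanh u.
have -> : 2 * u = ln (1 + x) - ln (1 - x) by rewrite /u; field.
rewrite expRD expRN !lnK ?posrE; try lra.
have /andP[t1 t2] := tanh_bounds u.
have n1 : 1 - x != 0 by rewrite gt_eqF //; lra.
have n2 : 1 - tanh u != 0 by rewrite gt_eqF //; lra.
by move/eqP; rewrite eqr_div // => /eqP; lra.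
Qed.

Lemma is_derive_tanh (R : realType) (u : R) :
  is_derive u 1 (@tanh R) (1 - tanh u ^+ 2).
Proof.
have c0 := cosh_gt0 u.
have cN0 : expR u + expR (- u) != 0 by rewrite gt_eqF.
have dV := @is_deriveV R (fun x => expR x + expR (- x)) u
  (expR u - expR (- u)) 1 cN0.
have d1 : is_derive u 1 (fun x : R => expR (- x)) (- expR (- u)).
  have := @is_derive1_comp R expR -%R u (expR (- u)) (-1) _ _.
  by rewrite mulrN1; apply.
have d2 : is_derive u 1 (fun x : R => expR x + expR (- x)) (expR u - expR (- u)).
  exact: is_deriveD.
have d3 : is_derive u 1 (fun x : R => expR x - expR (- x)) (expR u + expR (- u)).
  have := @is_deriveB _ _ _ expR _ u 1 (expR u) (- expR (- u)) _ d1.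
  by rewrite opprK; apply.
have D : is_derive u 1 (@tanh R) _ := is_deriveM d3 (dV d2).
apply: (is_derive_eq D).
rewrite /tanh /GRing.scale /=.
by field; rewrite gt_eqF.
Qed.

Lemma is_derive_monomial (R : realType) (c : R) (n : nat) (x : R) :
  is_derive x 1 (fun y : R => c * y ^+ n) (c * (n%:R * x ^+ n.-1)).
Proof.
have d := is_deriveX n (is_derive_id x 1).
have fE : c \*: id ^+ n = (fun y : R => c * y ^+ n).
  by apply/funext => y; rewrite !fctE.
have D : is_derive x 1 (c \*: id ^+ n) _ := is_deriveZ c d.
rewrite fE in D.
by apply: (is_derive_eq D); rewrite /GRing.scale /= mulr1.
Qed.

Lemma expr_norm_le1 (R : realType) (x : R) (n : nat) : `|x| <= 1 -> `|x ^+ n| <= 1.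
Proof. by move=> x1; rewrite normrX exprn_ile1. Qed.

(** The mean value theorem is applied to f between x and y, then to f'
    between x and the intermediate point; the constant is twice the sharp
    one. *)
Lemma taylor2_bound (R : realType) (f f' f'' : R -> R) (C x y : R) :
  (forall z : R, is_derive z 1 f (f' z)) ->
  (forall z : R, is_derive z 1 f' (f'' z)) ->
  (forall z : R, `|z| <= 1 -> `|f'' z| <= C) ->
  `|x| <= 1 -> `|y| <= 1 ->
  `|f y - f x - f' x * (y - x)| <= C * (y - x) ^+ 2.
Proof.
move=> df df' f''C.
have mvt (g g' : R -> R) a b : (forall z : R, is_derive z 1 g (g' z)) -> a <= b ->
    exists2 c, a <= c <= b & g b - g a = g' c * (b - a).
  move=> dg ab; have gc : {within `[a, b], continuous g}.
    by apply: derivable_within_continuous => z _; have [] := dg z.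
  have [c] := MVT_segment ab (fun z _ => dg z) gc.
  by rewrite in_itv /=; exists c.
have mvt' (g g' : R -> R) a b : (forall z : R, is_derive z 1 g (g' z)) ->
    `|a| <= 1 -> `|b| <= 1 ->
    exists c, [/\ `|c| <= 1, `|c - a| <= `|b - a| & g b - g a = g' c * (b - a)].
  move=> dg; rewrite !ler_norml => /andP[a1 a2] /andP[b1 b2].
  have [ab|/ltW ba] := leP a b.
    have [c /andP[ac cb] E] := mvt g g' a b dg ab; exists c; split=> //.
      by rewrite ler_norml; lra.
    by rewrite !ger0_norm ?subr_ge0 //; lra.
  have [c /andP[ac cb] E] := mvt g g' b a dg ba; exists c; split=> //.
    by rewrite ler_norml; lra.
  by rewrite !ler0_norm ?subr_le0 //; lra.
  by rewrite -[LHS]opprK opprB E; ring.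
move=> x1 y1.
have [c [c1 cxy ->]] := mvt' f f' x y df x1 y1.
have [d [d1 _ E]] := mvt' f' f'' x c df' x1 c1.
rewrite -mulrBl E !normrM -[(y - x) ^+ 2]real_normK ?num_real // expr2 mulrA.
apply: ler_wpM2r => //.
by apply: ler_pM => //; exact: f''C.
Qed.

(** * The local field and the quadratic drift *)

(** The argument of tanh in the Glauber kernel; local_field' and
    local_field'' are its successive derivatives. *)
Definition local_field (R : realType) (beta h : R) (p : nat) (x : R) : R :=
  p%:R * beta * x ^+ p.-1 + h.

Definition local_field' (R : realType) (beta : R) (p : nat) (x : R) : R :=
  p%:R * beta * p.-1%:R * x ^+ p.-2.

Definition local_field'' (R : realType) (beta : R) (p : nat) (x : R) : R :=
  p%:R * beta * p.-1%:R * p.-2%:R * x ^+ p.-2.-1.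

Lemma is_derive_local_field (R : realType) (beta h : R) p (x : R) :
  is_derive x 1 (local_field beta h p) (local_field' beta p x).
Proof.
have D : is_derive x 1 (local_field beta h p) _ :=
  is_deriveD (is_derive_monomial (p%:R * beta) p.-1 x) (is_derive_cst h x 1).
by apply: (is_derive_eq D); rewrite addr0 !mulrA.
Qed.

Lemma is_derive_local_field' (R : realType) (beta : R) p (x : R) :
  is_derive x 1 (local_field' beta p) (local_field'' beta p x).
Proof.
have D := is_derive_monomial (p%:R * beta * p.-1%:R) p.-2 x.
by apply: (is_derive_eq D); rewrite !mulrA.
Qed.

(** The exponent of the Gibbs weight per site; its derivative is the local
    field. *)
Definition energy (R : realType) (beta h : R) (p : nat) (x : R) : R :=
  beta * x ^+ p + h * x.

Lemma is_derive_energy (R : realType) (beta h : R) p (x : R) :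
  is_derive x 1 (energy beta h p) (local_field beta h p x).
Proof.
have D : is_derive x 1 (energy beta h p) _ :=
  is_deriveD (is_derive_monomial beta p x) (is_deriveZ h (is_derive_id x 1)).
by apply: (is_derive_eq D); rewrite /local_field /GRing.scale /=; ring.
Qed.

Lemma monomial_norm_le (R : realType) (c x : R) n :
  `|x| <= 1 -> `|c * x ^+ n| <= `|c|.
Proof. by move=> x1; rewrite normrM ler_piMr // expr_norm_le1. Qed.

Lemma energy_taylor (R : realType) (beta h : R) p (x y : R) :
  `|x| <= 1 -> `|y| <= 1 ->
  `|energy beta h p y - energy beta h p x - local_field beta h p x * (y - x)|
    <= `|p%:R * beta * p.-1%:R| * (y - x) ^+ 2.
Proof.
apply: (taylor2_bound (is_derive_energy beta h p) (is_derive_local_field beta h p)).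
by move=> z; exact: monomial_norm_le.
Qed.

(** The equations H'(m) = 0 and H''(m) = 0, the former after applying tanh
    and the latter multiplied by 1 - m^2. *)
Definition degenerate (R : realType) (beta h : R) (p : nat) (m : R) : Prop :=
  [/\ -1 < m < 1, tanh (local_field beta h p m) = m &
      (1 - m ^+ 2) * local_field' beta p m = 1].

(** At m the function tanh (u x) - x vanishes together with its derivative,
    so the Taylor bound applies with an upper bound of the second derivative
    on [-1, 1]. *)
Lemma drift_quadratic (R : realType) (beta h : R) p (m : R) :
  degenerate beta h p m ->
  exists2 C : R, 0 <= C & forall x, `|x| <= 1 ->
    `|tanh (local_field beta h p x) - x| <= C * (x - m) ^+ 2.
Proof.
case=> m1 Fm F'm.
pose T x := tanh (local_field beta h p x).
pose f' x := (1 - T x ^+ 2) * local_field' beta p x - 1.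
pose f'' x := (1 - T x ^+ 2) * local_field'' beta p x
  - 2 * T x * (1 - T x ^+ 2) * local_field' beta p x ^+ 2.
have dT (x : R) : is_derive x 1 T ((1 - T x ^+ 2) * local_field' beta p x).
  exact: is_derive1_comp (is_derive_tanh _) (is_derive_local_field _ _ _ _).
have df (x : R) : is_derive x 1 (fun y => T y - y) (f' x).
  exact: is_deriveB (dT x) (is_derive_id x 1).
have df' (x : R) : is_derive x 1 f' (f'' x).
  have D1 : is_derive x 1 (fun y => T y ^+ 2) _ := is_deriveM (dT x) (dT x).
  have D2 : is_derive x 1 (fun y => 1 - T y ^+ 2) _ :=
    is_deriveB (is_derive_cst (1 : R) x 1) D1.
  have D3 : is_derive x 1 f' _ :=
    is_deriveB (is_deriveM D2 (is_derive_local_field' beta p x))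
               (is_derive_cst (1 : R) x 1).
  by apply: (is_derive_eq D3); rewrite /f'' /GRing.scale /=; ring.
pose K1 := `|p%:R * beta * p.-1%:R|.
pose K2 := `|p%:R * beta * p.-1%:R * p.-2%:R|.
exists (K2 + 2 * K1 ^+ 2); first by rewrite addr_ge0 ?normr_ge0 // mulr_ge0 ?sqr_ge0.
move=> x x1.
have m1' : `|m| <= 1 by rewrite ler_norml; lra.
have := taylor2_bound (C := K2 + 2 * K1 ^+ 2) df df' _ m1' x1.
have -> : f' m = 0 by rewrite /f' {1}/T Fm F'm subrr.
rewrite {2}/T Fm subrr mul0r !subr0; apply=> z z1.
have /andP[t1 t2] := tanh_bounds (local_field beta h p z).
rewrite -/(T z) in t1 t2.
have T1 : `|T z| <= 1 by rewrite ler_norml; lra.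
have S1 : `|1 - T z ^+ 2| <= 1.
  by rewrite ler_norml; apply/andP; split; nra.
have L1 : `|local_field' beta p z| <= K1 by exact: monomial_norm_le.
have L2 : `|local_field'' beta p z| <= K2 by exact: monomial_norm_le.
rewrite /f''; move: (T z) T1 S1 {t1 t2} => t T1 S1.
move: (local_field' beta p z) L1 => l1 L1.
move: (local_field'' beta p z) L2 => l2 L2.
apply: le_trans (ler_normB _ _) _; apply: lerD.
  by rewrite normrM -[leRHS]mul1r; apply: ler_pM.
rewrite (normrM _ (l1 ^+ 2)) normrX (normrM _ (1 - t ^+ 2)) normrM (ger0_norm (ler0n _ 2)).
rewrite -!mulrA; apply: ler_wpM2l => //.
rewrite -[leRHS]mul1r; apply: ler_pM; rewrite ?mulr_ge0 ?exprn_ge0 //.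
rewrite -[leRHS]mul1r; apply: ler_pM; rewrite ?exprn_ge0 //.
by rewrite lerXn2r ?nnegrE // (le_trans _ L1).
Qed.

(** * Degenerate critical points on the boundary curves *)

Lemma is_derive_cw_H (R : realType) (beta h : R) p (x : R) : -1 < x < 1 ->
  is_derive x 1 (cw_H beta h p)
    (local_field beta h p x - 2^-1 * (ln (1 + x) - ln (1 - x))).
Proof.
move=> /andP[x1 x2].
have Dp : is_derive x 1 (fun y : R => 1 + y) _ :=
  is_deriveD (is_derive_cst (1 : R) x 1) (is_derive_id x 1).
have Dm : is_derive x 1 (fun y : R => 1 - y) _ :=
  is_deriveB (is_derive_cst (1 : R) x 1) (is_derive_id x 1).
have p0 : 0 < 1 + x by lra.
have m0 : 0 < 1 - x by lra.
have Lp : is_derive x 1 (fun y : R => ln (1 + y)) _ :=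
  is_derive1_comp (is_derive1_ln p0) Dp.
have Lm : is_derive x 1 (fun y : R => ln (1 - y)) _ :=
  @is_derive1_comp R _ (fun y : R => 1 - y) x _ _ (is_derive1_ln m0) Dm.
have DI : is_derive x 1 (@cw_entropy R) _ :=
  is_deriveZ 2^-1 (is_deriveD (is_deriveM Dp Lp) (is_deriveM Dm Lm)).
have D : is_derive x 1 (cw_H beta h p) _ :=
  is_deriveB (is_derive_energy beta h p x) DI.
apply: (is_derive_eq D); rewrite /GRing.scale /=.
by field; rewrite !gt_eqF.
Qed.

Lemma derive1_cw_H (R : realType) (beta h : R) p (x : R) : -1 < x < 1 ->
  derive1 (cw_H beta h p) x =
    local_field beta h p x - 2^-1 * (ln (1 + x) - ln (1 - x)).
Proof. by move=> /(is_derive_cw_H beta h p) D; rewrite derive1E derive_val. Qed.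

Lemma derive2_cw_H (R : realType) (beta h : R) p (x : R) : -1 < x < 1 ->
  derive1n 2 (cw_H beta h p) x = local_field' beta p x - (1 - x ^+ 2)^-1.
Proof.
move=> /[dup] xI /andP[x1 x2].
have p0 : 0 < 1 + x by lra.
have m0 : 0 < 1 - x by lra.
have Lp : is_derive x 1 (fun y : R => ln (1 + y)) _ :=
  is_derive1_comp (is_derive1_ln p0)
    (is_deriveD (is_derive_cst (1 : R) x 1) (is_derive_id x 1)).
have Lm : is_derive x 1 (fun y : R => ln (1 - y)) _ :=
  @is_derive1_comp R _ (fun y : R => 1 - y) x _ _ (is_derive1_ln m0)
    (is_deriveB (is_derive_cst (1 : R) x 1) (is_derive_id x 1)).
have D : is_derive x 1 (fun y : R =>
    local_field beta h p y - 2^-1 * (ln (1 + y) - ln (1 - y))) _ :=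
  is_deriveB (is_derive_local_field beta h p x) (is_deriveZ 2^-1 (is_deriveB Lp Lm)).
rewrite /= derive1E.
rewrite (@near_eq_derive _ _ _ _ (fun y : R =>
    local_field beta h p y - 2^-1 * (ln (1 + y) - ln (1 - y)))).
  rewrite derive_val /GRing.scale /=; field.
  by rewrite !gt_eqF //; nra.
have xI' : x \in `]-1, 1[ by rewrite in_itv.
near=> y; apply: derive1_cw_H.
have : y \in `]-1, 1[ by near: y; exact: near_in_itvoo.
by rewrite in_itv.
Unshelve. all: by end_near. Qed.

Lemma tanhN (R : realType) (u : R) : tanh (- u) = - tanh u.
Proof. by rewrite /tanh opprK -[RHS]mulNr opprB [X in _ / X = _]addrC. Qed.

Lemma degenerate_of_cw_H (R : realType) (beta h : R) p (m : R) :
  -1 < m < 1 -> h = - derive1 (cw_H beta 0 p) m ->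
  derive1n 2 (cw_H beta 0 p) m = 0 -> degenerate beta h p m.
Proof.
move=> m1; rewrite derive1_cw_H // derive2_cw_H // => hE dE; split=> //.
  rewrite -[RHS](tanh_half_ln m1); congr tanh.
  by rewrite hE /local_field; ring.
have /andP[m2 m3] := m1.
have m0 : 1 - m ^+ 2 != 0 by rewrite gt_eqF //; nra.
by rewrite -[local_field' _ _ _](subrK (1 - m ^+ 2)^-1) dE add0r divff.
Qed.

(** For even p the model is invariant under the global spin flip combined
    with h |-> -h. *)
Lemma degenerate_opp (R : realType) (beta h : R) p (m : R) : ~~ odd p -> (1 < p)%N ->
  degenerate beta h p m -> degenerate beta (- h) p (- m).
Proof.
case: p => [|[|p]] // ep _ [/andP[m1 m2] Fm F'm]; split.
- by apply/andP; split; lra.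
- have -> : local_field beta (- h) p.+2 (- m) = - local_field beta h p.+2 m.
    rewrite /local_field exprNn -signr_odd /= -[odd p]negbK.
    by move: ep; rewrite /= negbK => /negbTE ->; rewrite expr1; ring.
  by rewrite tanhN Fm.
- have -> : local_field' beta p.+2 (- m) = local_field' beta p.+2 m.
    rewrite /local_field' exprNn -signr_odd.
    by move: ep; rewrite /= negbK => /negbTE ->; rewrite expr0 mul1r.
  by rewrite sqrrN.
Qed.

(** The function x^(p-2) (1 - x^2) is maximal at x^2 = (p-2)/p, and beta_hat
    is the value of beta for which H'' vanishes at that point. *)
Lemma beta_hat_crosses (R : realType) (n : nat) (beta : R) : (0 < n)%N ->
  beta_hat R n.+2 < beta ->
  exists2 x : R, 0 < x < 1 & 1 < (1 - x ^+ 2) * local_field' beta n.+2 x.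
Proof.
move=> n0 hbeta.
have nR : 0 < n%:R :> R by rewrite ltr0n.
have pE : n.+2%:R = n%:R + 2 :> R by rewrite -addn2 natrD.
(* x is the maximizer (n / (n + 2))^(1/2), and x^n cancels the power in
   beta_hat. *)
pose r : R := (n%:R + 2) / n%:R.
have r1 : 1 < r by rewrite /r ltr_pdivlMr //; lra.
have r0 : 0 < r by lra.
pose x : R := r `^ (- 2^-1).
have x0 : 0 < x by rewrite powR_gt0.
have x2 : x ^+ 2 = n%:R / (n%:R + 2).
  rewrite -powR_mulrn ?ltW // -powRrM mulNr mulVf ?pnatr_eq0 // powR_inv1 ?ltW //.
  by rewrite invf_div.
have xn : x ^+ n * r `^ (n%:R / 2) = 1.
  rewrite -powR_mulrn ?ltW // -powRrM -powRD; last by rewrite (gt_eqF r0) implybT.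
  have -> : - 2^-1 * n%:R + n%:R / 2 = 0 :> R by lra.
  by rewrite powRr0.
exists x.
  rewrite x0 /=.
  have x21 : x ^+ 2 < 1 by rewrite x2 ltr_pdivrMr; lra.
  by nra.
move: hbeta; rewrite /beta_hat pE addrK -/r => hbeta.
have xn0 : 0 < x ^+ n by rewrite exprn_gt0.
have -> : (1 - x ^+ 2) * local_field' beta n.+2 x = 2 * (n%:R + 1) * beta * x ^+ n.
  rewrite x2 /local_field' pE /= -natr1.
  by field; rewrite gt_eqF //; lra.
have n1 : 0 < 2 * (n%:R + 1) :> R by lra.
have E : 2 * (n%:R + 2 - 1) = 2 * (n%:R + 1) :> R by ring.
rewrite E in hbeta.
have E1 : 2 * (n%:R + 1) * ((2 * (n%:R + 1))^-1 * r `^ (n%:R / 2)) * x ^+ n = 1.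
  by rewrite mulrA divff ?gt_eqF // mul1r mulrC xn.
by rewrite -[ltLHS]E1 ltr_pM2r // ltr_pM2l.
Qed.

Lemma closed_sup (R : realType) (A : set R) :
  closed A -> A !=set0 -> has_ubound A -> A (sup A).
Proof. by move=> cA A0 Aub; apply: cA; exact: closure_sup. Qed.

Lemma closed_inf (R : realType) (A : set R) :
  closed A -> A !=set0 -> has_lbound A -> A (inf A).
Proof.
move=> cA A0 Alb.
have : [set - x | x in A] (sup [set - x | x in A]).
  apply: closed_sup.
  - have -> : [set - x | x in A] = -%R @^-1` A.
      apply/seteqP; split=> [_ [x Ax <-]|x Ax] /=; first by rewrite opprK.
      by exists (- x) => //; rewrite opprK.
    by apply: preimage_closed => // x _; exact: opp_continuous.
  - by case: A0 => x Ax; exists (- x), x.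
  - by rewrite -has_lb_ubN.
by move=> [x Ax xE]; rewrite /inf -xE opprK.
Qed.

(** Multiplied by 1 - x^2, the equation H''(x) = 0 extends continuously to
    [0, 1] without gaining the endpoints as solutions, so the set of roots
    is closed. *)
Lemma H2_rootsE (R : realType) (beta : R) (n : nat) : (0 < n)%N ->
  H2_roots beta n.+2 =
  `[0, 1] `&` (fun x => (1 - x ^+ 2) * local_field' beta n.+2 x) @^-1` [set 1].
Proof.
move=> n0; apply/seteqP; split=> x /=; rewrite /H2_roots /= in_itv /=.
  move=> [/andP[x0 x1]].
  have xI : -1 < x < 1 by lra.
  have /= -> := derive2_cw_H beta 0 n.+2 xI => /eqP.
  rewrite subr_eq0 => /eqP ->; split; first lra.
  by rewrite divff // gt_eqF //; nra.
move=> [/andP[x0 x1] E].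
have xn0 : x != 0.
  apply/eqP => x0'; move: E => /eqP.
  rewrite /local_field' x0' /= [0 ^+ n]expr0n (gtn_eqF n0).
  by rewrite !mulr0 eq_sym oner_eq0.
have xn1 : x != 1.
  by apply/eqP => x1'; move: E => /eqP; rewrite x1' expr1n subrr mul0r eq_sym oner_eq0.
have x0' : 0 < x by rewrite lt_neqAle eq_sym xn0.
have x1' : x < 1 by rewrite lt_neqAle xn1.
have xI : -1 < x < 1 by lra.
split; first by rewrite x0' x1'.
have /= -> := derive2_cw_H beta 0 n.+2 xI; apply/eqP; rewrite subr_eq0; apply/eqP.
have q0 : 1 - x ^+ 2 != 0 by rewrite gt_eqF //; nra.
by apply: (mulfI q0); rewrite E divff.
Qed.

Lemma continuous_curvature (R : realType) (beta : R) (p : nat) :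
  continuous (fun x : R => (1 - x ^+ 2) * local_field' beta p x).
Proof.
move=> x; apply: differentiable_continuous; apply/derivable1_diffP.
apply: derivableM; last by have [] := is_derive_local_field' beta p x.
apply: derivableB; first exact: derivable_cst.
by have [] := is_derive_monomial 1 2 x; under eq_fun do rewrite mul1r.
Qed.

(** The set of roots is closed, bounded, and nonempty by the intermediate
    value theorem, so that its infimum and supremum are roots. *)
Lemma H2_roots_extrema (R : realType) (beta : R) (p : nat) : (3 <= p)%N ->
  beta_hat R p < beta ->
  H2_roots beta p (a1 p beta) /\ H2_roots beta p (a2 p beta).
Proof.
case: p => [|[|n]] // n0 hbeta.
have {}n0 : (0 < n)%N by [].
have [x /andP[x0 x1] qx] := beta_hat_crosses n0 hbeta.
have cq := @continuous_curvature R beta n.+2.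
have cl : closed (H2_roots beta n.+2).
  rewrite H2_rootsE //; apply: closedI; first exact: itv_closed.
  by apply: preimage_closed => // y _; exact: cq.
have ne : H2_roots beta n.+2 !=set0.
  pose q y : R := (1 - y ^+ 2) * local_field' beta n.+2 y.
  have q0x : Num.min (q 0) (q x) <= 1 <= Num.max (q 0) (q x).
    rewrite ge_min le_max {1}/q /local_field' /= [0 ^+ n]expr0n (gtn_eqF n0).
    by rewrite !mulr0 ler01 /= (ltW qx) orbT.
  have [y yI yE] := IVT (ltW x0) (continuous_subspaceT cq) q0x.
  exists y; rewrite H2_rootsE //; split=> //=.
  by move: yI; rewrite !in_itv /=; lra.
split.
  by apply: closed_inf => //; exists 0 => y [/andP[/ltW]].
by apply: closed_sup => //; exists 1 => y [/andP[_ /ltW]].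
Qed.

Lemma derive1_cw_H_opp (R : realType) (beta : R) p (x : R) : ~~ odd p ->
  -1 < x < 1 ->
  derive1 (cw_H beta 0 p) (- x) = - derive1 (cw_H beta 0 p) x.
Proof.
move=> ep xI; have xI' : -1 < - x < 1 by lra.
rewrite !derive1_cw_H // /local_field opprK.
case: p ep => [|p] /= ep; first by ring.
rewrite exprNn -signr_odd; move: ep; rewrite negbK => ->.
by rewrite expr1; ring.
Qed.

(** Each curve is h = - H'(m) with m one of a1, a2 or their opposites; for
    even p, H' is odd, which covers the opposite values of m and of h. *)
Lemma frakB_degenerate (R : realType) (p : nat) (beta h : R) : (3 <= p)%N ->
  frakB p (beta, h) -> exists m, degenerate beta h p m.
Proof.
move=> p3.
have root (a : R) : H2_roots beta p a ->
    degenerate beta (- derive1 (cw_H beta 0 p) a) p a.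
  move=> [/andP[a0 a1] E]; apply: degenerate_of_cw_H => //.
  by apply/andP; split; lra.
have rootN (a : R) : ~~ odd p -> H2_roots beta p a ->
    degenerate beta (- derive1 (cw_H beta 0 p) (- a)) p (- a).
  move=> ep /[dup] /root D [/andP[a0 a1] _].
  rewrite derive1_cw_H_opp //; last by apply/andP; split; lra.
  exact: degenerate_opp ep (ltnW p3) D.
have flip (h' m : R) : ~~ odd p -> degenerate beta h' p m ->
    exists m', degenerate beta (- h') p m'.
  by move=> ep D; exists (- m); exact: degenerate_opp ep (ltnW p3) D.
have ends : beta_hat R p < beta ->
    H2_roots beta p (a1 p beta) /\ H2_roots beta p (a2 p beta).
  exact: H2_roots_extrema.
have Ueven : ~~ odd p -> beta_hat R p < beta ->
    exists m, degenerate beta (U_even p beta) p m.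
  move=> ep /ends[r1 r2]; rewrite /U_even; case: leP => _.
  - by exists (- a2 p beta); exact: rootN.
  - by exists (a1 p beta); exact: root.
rewrite /frakB; case: ifPn => [op|ep]; rewrite /graph_on /= ?in_itv /=.
  rewrite !andbT => -[] [/ends[r1 r2] ->].
  - by exists (a1 p beta); exact: root.
  - by exists (a2 p beta); exact: root.
rewrite !andbT => -[[[|]|]|] [].
- by move=> hb ->; exact: Ueven.
- by move=> hb ->; have [m] := Ueven ep hb; exact: flip.
- by move=> /andP[/ends[_ r2] _] ->; exists (a2 p beta); exact: root.
- by move=> /andP[/ends[_ r2] _] ->; exact: flip (root _ r2).
Qed.

(** * Mean evolution along the Glauber chain *)

Lemma magnetization_set_spin (R : realType) (N : nat) (x : cube N) i b :
  magnetization R (set_spin x i b) =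
  magnetization R x + N%:R^-1 * (spin b - spin (x i)).
Proof.
rewrite /magnetization -mulrDr; congr (_ * _).
rewrite (bigD1 i) //= [in RHS](bigD1 i) //= ffunE eqxx.
under eq_bigr => j /negbTE ji do rewrite ffunE ji.
by ring.
Qed.

Lemma magnetization_norm_le1 (R : realType) (N : nat) (x : cube N) :
  `|magnetization R x| <= 1.
Proof.
rewrite /magnetization normrM ger0_norm ?invr_ge0 ?ler0n //.
have [N0|N0] := eqVneq N 0%N.
  by have -> : N%:R = 0 :> R; [rewrite N0|rewrite invr0 mul0r].
rewrite ler_pdivrMl ?ltr0n ?lt0n // mulr1.
apply: le_trans (ler_norm_sum _ _ _) _.
apply: (@le_trans _ _ (\sum_(i < N) 1)); last by rewrite sumr_const card_ord.
by apply: ler_sum => i _; rewrite /spin; case: (x i); rewrite ?normrN normr1.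
Qed.

Lemma glauber_kernel_mean (R : realType) (beta h : R) p N (x : cube N) (f : cube N -> R) :
  \sum_y glauber_kernel beta h p x y * f y =
  \sum_(i < N) N%:R^-1 * \sum_(b : bool)
    spin_law (tanh (local_field beta h p (magnetization R x))) b
    * f (set_spin x i b).
Proof.
under eq_bigr do rewrite /glauber_kernel -/(local_field beta h p _) mulr_suml /=.
rewrite exchange_big /=; apply: eq_bigr => i _.
under eq_bigr do rewrite -mulrA; rewrite -mulr_sumr /=; congr (_ * _).
under eq_bigr do rewrite mulr_suml /=.
rewrite exchange_big /=; apply: eq_bigr => b _.
rewrite (bigD1 (set_spin x i b)) //= eqxx mulr1 big1 ?addr0 // => y /negbTE ->.
by rewrite mulr0 mul0r.
Qed.

Lemma spin_law_ge0 (R : realType) (u : R) b : 0 <= spin_law (tanh u) b.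
Proof.
have /andP[t1 t2] := tanh_bounds u.
by rewrite /spin_law /spin divr_ge0 //; case: b; lra.
Qed.

Lemma glauber_law_ge0 (R : realType) (beta h : R) p N (x : cube N) t y :
  0 <= glauber_law beta h p x t y.
Proof.
elim: t y => [|t IH] y /=; first by rewrite ler0n.
apply: sumr_ge0 => z _; rewrite mulr_ge0 //; apply: sumr_ge0 => i _.
rewrite mulr_ge0 ?invr_ge0 ?ler0n //; apply: sumr_ge0 => b _.
by rewrite mulr_ge0 ?ler0n // spin_law_ge0.
Qed.

Lemma glauber_law_mean0 (R : realType) (beta h : R) p N (x : cube N) (f : cube N -> R) :
  \sum_y glauber_law beta h p x 0 y * f y = f x.
Proof.
rewrite (bigD1 x) //= eqxx mul1r big1 ?addr0 // => y /negbTE ->.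
by rewrite mul0r.
Qed.

Lemma glauber_law_meanS (R : realType) (beta h : R) p N (x : cube N) t (f : cube N -> R) :
  \sum_y glauber_law beta h p x t.+1 y * f y =
  \sum_z glauber_law beta h p x t z * \sum_y glauber_kernel beta h p z y * f y.
Proof.
under eq_bigr do rewrite /= mulr_suml /=.
rewrite exchange_big /=; apply: eq_bigr => z _.
by rewrite mulr_sumr /=; apply: eq_bigr => y _; rewrite mulrA.
Qed.

Lemma glauber_law_sum1 (R : realType) (beta h : R) p N (x : cube N) t : (0 < N)%N ->
  \sum_y glauber_law beta h p x t y = 1.
Proof.
move=> N0; have NR : N%:R != 0 :> R by rewrite pnatr_eq0 -lt0n.
suff <- : \sum_y glauber_law beta h p x t y * 1 = 1.
  by apply: eq_bigr => y _; rewrite mulr1.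
elim: t => [|t IH]; first by rewrite glauber_law_mean0.
rewrite glauber_law_meanS -[RHS]IH; apply: eq_bigr => z _; congr (_ * _).
rewrite glauber_kernel_mean.
under eq_bigr do rewrite big_bool /= /spin_law /spin !mulr1 -mulrDl mul1r mulN1r.
rewrite sumr_const card_ord -[LHS]mulr_natl mulVKf //.
by lra.
Qed.

Lemma glauber_law_mean_growth (R : realType) (beta h : R) p N (x : cube N) t
    (f : cube N -> R) (e : R) : (0 < N)%N ->
  (forall z, \sum_y glauber_kernel beta h p z y * f y <= f z + e) ->
  \sum_y glauber_law beta h p x t y * f y <= f x + t%:R * e.
Proof.
move=> N0 fe; elim: t => [|t IH]; first by rewrite glauber_law_mean0 mul0r addr0.
rewrite glauber_law_meanS.
apply: (@le_trans _ _ (\sum_z glauber_law beta h p x t z * (f z + e))).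
  by apply: ler_sum => z _; rewrite ler_wpM2l ?glauber_law_ge0.
under eq_bigr do rewrite mulrDr.
rewrite big_split /= -mulr_suml /= glauber_law_sum1 // mul1r.
by rewrite -natr1 mulrDl mul1r addrA lerD2r.
Qed.

(** * Confinement of the chain near a degenerate point *)

(** A square saturating at 1. It makes the third moment in the drift
    harmless, which would not be bounded in terms of the mean of y^2. *)
Definition psi (R : realType) (y : R) : R := y ^+ 2 / (1 + y ^+ 2).

Definition psi' (R : realType) (y : R) : R := 2 * y / (1 + y ^+ 2) ^+ 2.

Lemma psi_ge0 (R : realType) (y : R) : 0 <= psi y.
Proof. by rewrite /psi divr_ge0 ?addr_ge0 ?sqr_ge0. Qed.

Lemma psi_le_sqr (R : realType) (y : R) : psi y <= y ^+ 2.
Proof.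
have y2 := sqr_ge0 y.
by rewrite /psi ler_pdivrMr; [rewrite mulrDr mulr1 lerDl mulr_ge0|lra].
Qed.

Lemma psi_mono (R : realType) (d y : R) : 0 <= d -> d <= `|y| -> psi d <= psi y.
Proof.
move=> d0 dy; rewrite /psi -(real_normK (num_real y)).
move: (`|y|) dy => z dz.
have d2 := sqr_ge0 d; have z2 := sqr_ge0 z.
rewrite ler_pdivrMr; last by lra.
rewrite mulrAC ler_pdivlMr; last by lra.
have : d ^+ 2 <= z ^+ 2 by rewrite lerXn2r ?nnegrE //; lra.
by lra.
Qed.

(** The exact remainder has the sign of a polynomial that is nonnegative as
    soon as |d| <= 2. *)
Lemma psi_step (R : realType) (y d : R) : `|d| <= 2 ->
  psi (y + d) <= psi y + psi' y * d + 3 * d ^+ 2.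
Proof.
rewrite ler_norml => /andP[d1 d2].
pose A := 1 + y ^+ 2; pose B := 1 + (y + d) ^+ 2.
have A1 : 1 <= A by rewrite lerDl sqr_ge0.
have B1 : 1 <= B by rewrite lerDl sqr_ge0.
rewrite -subr_ge0.
have -> : psi y + psi' y * d + 3 * d ^+ 2 - psi (y + d) =
    d ^+ 2 * (3 * A ^+ 2 * B - A + 4 * y ^+ 2 + 2 * y * d) / (A ^+ 2 * B).
  rewrite /psi /psi' /A /B; field.
  by rewrite !gt_eqF //; [move: A1|move: B1]; rewrite /A /B; lra.
apply: divr_ge0; last by apply: mulr_ge0; [exact: sqr_ge0|lra].
apply: mulr_ge0; first exact: sqr_ge0.
have AB : A <= A ^+ 2 * B by nra.
have yd : - (2 * A) <= 2 * y * d.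
  rewrite -subr_ge0.
  have -> : 2 * y * d - - (2 * A) =
      (1 + d / 2) * (y + 1) ^+ 2 + (1 - d / 2) * (y - 1) ^+ 2 by rewrite /A; field.
  by apply: addr_ge0; apply: mulr_ge0; rewrite ?sqr_ge0 //; lra.
have := sqr_ge0 y; lra.
Qed.

Lemma psi'_bound (R : realType) (y : R) : `|psi' y| * y ^+ 2 <= 2.
Proof.
rewrite -(real_normK (num_real y)) /psi' normrM normrV; last first.
  by rewrite unitfE expf_neq0 // gt_eqF // ltr_pwDl ?sqr_ge0.
rewrite normrM (ger0_norm (ler0n _ 2)) normrX (ger0_norm (_ : 0 <= 1 + y ^+ 2)); last first.
  by rewrite addr_ge0 ?sqr_ge0.
rewrite -(real_normK (num_real y)).
move: (`|y|) (normr_ge0 y) => z z0.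
rewrite mulrAC ler_pdivrMr; last by rewrite exprn_gt0 // ltr_pwDl ?sqr_ge0.
have : 0 <= (z - 1) ^+ 2 * z ^+ 2 by rewrite mulr_ge0 ?sqr_ge0.
by have := sqr_ge0 z; have := sqr_ge0 (z ^+ 2); nra.
Qed.

(** With y = s (xbar - m), the increment of y has conditional mean (s / N)
    (tanh (u xbar) - xbar), of absolute value at most C y^2 / s^4, and its
    square is at most 4 / s^4; moreover |psi' y| y^2 <= 2. *)
Lemma psi_drift (R : realType) (beta h : R) p (m C s : R) N (z : cube N) :
  (forall x, `|x| <= 1 ->
    `|tanh (local_field beta h p x) - x| <= C * (x - m) ^+ 2) ->
  0 <= C -> 1 <= s -> s ^+ 3 = N%:R ->
  \sum_y glauber_kernel beta h p z y * psi (s * (magnetization R y - m)) <=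
  psi (s * (magnetization R z - m)) + (2 * C + 12) / s ^+ 4.
Proof.
move=> drift C0 s1 sN.
have s0 : 0 < s by lra.
have N0 : 0 < N%:R :> R by rewrite -sN exprn_gt0.
rewrite glauber_kernel_mean.
have M1 := magnetization_norm_le1 R z.
have drM := drift _ M1.
set M := magnetization R z in M1 drM *.
set F := tanh _ in drM *.
set y := s * (M - m).
have /andP[F1 F2] : -1 < F < 1 := tanh_bounds _.
pose e := 12 / s ^+ 4.
have step i b : psi (s * (magnetization R (set_spin z i b) - m)) <=
    psi y + psi' y * (s / N%:R * (spin b - spin (z i))) + e.
  have sp : `|spin b - spin (z i) : R| <= 2.
    by rewrite /spin ler_norml; case: b; case: (z i); apply/andP; split; lra.
  rewrite magnetization_set_spin -/M.
  set d := s / N%:R * _.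
  have -> : s * (M + N%:R^-1 * (spin b - spin (z i)) - m) = y + d.
    by rewrite /y /d; ring.
  have dE : `|d| <= 2 / s ^+ 2.
    rewrite /d -sN normrM ger0_norm; last by rewrite divr_ge0 ?exprn_ge0 // ltW.
    have -> : s / s ^+ 3 = (s ^+ 2)^-1 by field; rewrite gt_eqF.
    by rewrite mulrC ler_wpM2r // invr_ge0 exprn_ge0 // ltW.
  have d2 : `|d| <= 2.
    apply: le_trans dE _; rewrite ler_pdivrMr ?exprn_gt0 //.
    by rewrite ler_peMr // exprn_ege1.
  apply: le_trans (psi_step y d2) _; rewrite lerD2l /e.
  have -> : 12 / s ^+ 4 = 3 * (2 / s ^+ 2) ^+ 2 by field; rewrite gt_eqF.
  rewrite ler_wpM2l // -(real_normK (num_real d)) lerXn2r ?nnegrE //.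
  by rewrite divr_ge0 // exprn_ge0 // ltW.
have mean i : \sum_(b : bool) spin_law F b *
      psi (s * (magnetization R (set_spin z i b) - m)) <=
    psi y + psi' y * (s / N%:R * (F - spin (z i))) + e.
  apply: (@le_trans _ _ (\sum_(b : bool) spin_law F b *
    (psi y + psi' y * (s / N%:R * (spin b - spin (z i))) + e))).
    by apply: ler_sum => b _; rewrite ler_wpM2l ?spin_law_ge0.
  rewrite big_bool /= /spin_law /spin le_eqVlt; apply/orP; left; apply/eqP.
  by field; rewrite gt_eqF.
apply: (@le_trans _ _ (\sum_(i < N) N%:R^-1 *
    (psi y + psi' y * (s / N%:R * (F - spin (z i))) + e))).
  by apply: ler_sum => i _; rewrite ler_wpM2l // invr_ge0 ltW.
have -> : \sum_(i < N) N%:R^-1 *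
      (psi y + psi' y * (s / N%:R * (F - spin (z i))) + e) =
    psi y + e + psi' y * (s / N%:R) * (F - M).
  pose P := psi y + e + psi' y * (s / N%:R) * F.
  rewrite -mulr_sumr.
  transitivity (N%:R^-1 * \sum_(i < N) (P - psi' y * (s / N%:R) * spin (z i))).
    by congr (_ * _); apply: eq_bigr => i _; rewrite /P; ring.
  rewrite sumrB sumr_const card_ord -mulr_sumr -[P *+ N]mulr_natl /P /M /magnetization.
  by field; rewrite gt_eqF.
rewrite -addrA lerD2l.
have -> : s / N%:R = (s ^+ 2)^-1 by rewrite -sN; field; rewrite gt_eqF.
have : psi' y * (s ^+ 2)^-1 * (F - M) <= 2 * C / s ^+ 4.
  apply: le_trans (ler_norm _) _; rewrite (normrM (psi' y * _)) (normrM (psi' y)).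
  rewrite [`|(s ^+ 2)^-1|]ger0_norm; last by rewrite invr_ge0 exprn_ge0 // ltW.
  have drM' : `|F - M| <= C * (y ^+ 2 / s ^+ 2).
    have -> // : y ^+ 2 / s ^+ 2 = (M - m) ^+ 2.
    by rewrite /y; field; rewrite gt_eqF.
  apply: (@le_trans _ _ (`|psi' y| * (s ^+ 2)^-1 * (C * (y ^+ 2 / s ^+ 2)))).
    by rewrite ler_wpM2l // mulr_ge0 // invr_ge0 exprn_ge0 // ltW.
  have -> : `|psi' y| * (s ^+ 2)^-1 * (C * (y ^+ 2 / s ^+ 2)) =
    (`|psi' y| * y ^+ 2) * C / s ^+ 4 by field; rewrite gt_eqF.
  apply: ler_wpM2r; first by rewrite invr_ge0 exprn_ge0 // ltW.
  by rewrite ler_wpM2r // psi'_bound.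
by rewrite /e; lra.
Qed.

(** Markov's inequality for psi, which is at least psi d outside the window. *)
Lemma glauber_law_confined (R : realType) (beta h : R) p (m : R) :
  degenerate beta h p m ->
  exists2 K : R, 0 < K & forall N (x : cube N) (s d : R) t,
    1 <= s -> s ^+ 3 = N%:R -> 0 < d ->
    1 - (psi (s * (magnetization R x - m)) + t%:R * (K / s ^+ 4)) / psi d <=
    \sum_(y in [set y : cube N | `|s * (magnetization R y - m)| <= d]%SET)
       glauber_law beta h p x t y.
Proof.
move=> /drift_quadratic[C C0 drift]; exists (2 * C + 12); first by lra.
move=> N x s d t s1 sN d0; set A := finset _.
have N0 : (0 < N)%N.
  by rewrite -(ltr0n R) -sN exprn_gt0 //; lra.
have growth := glauber_law_mean_growth x t N0
  (fun z => psi_drift z drift C0 s1 sN).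
have psid : 0 < psi d.
  by rewrite /psi divr_gt0 ?exprn_gt0 // ltr_pwDl ?sqr_ge0.
rewrite lerBlDr -[leLHS](glauber_law_sum1 beta h p x t N0) (bigID (mem A)) /= lerD2l.
rewrite ler_pdivlMr //; apply: le_trans growth.
rewrite [leRHS](bigID (mem A)) /= -[leLHS]add0r; apply: lerD.
  by apply: sumr_ge0 => y _; rewrite mulr_ge0 ?glauber_law_ge0 ?psi_ge0.
rewrite mulr_suml /=; apply: ler_sum => y; rewrite inE -ltNge => /ltW dy.
by rewrite ler_wpM2l ?glauber_law_ge0 // psi_mono // ltW.
Qed.

(** * Gibbs weights of the magnetization levels *)

Definition plus_count (N : nat) (x : cube N) : nat := #|[set i | x i]%SET|.

Definition level_magnetization (R : realType) (N k : nat) : R := 2 * k%:R / N%:R - 1.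

Lemma magnetization_plus_count (R : realType) (N : nat) (x : cube N) : (0 < N)%N ->
  magnetization R x = level_magnetization R N (plus_count x).
Proof.
move=> N0; have NR : N%:R != 0 :> R by rewrite pnatr_eq0 -lt0n.
rewrite /magnetization /level_magnetization /plus_count.
have -> : \sum_(i < N) spin (x i) = 2 * #|[set i | x i]%SET|%:R - N%:R :> R.
  have -> : \sum_(i < N) spin (x i) = \sum_(i < N) (2 * (x i)%:R - 1) :> R.
    by apply: eq_bigr => i _; rewrite /spin; case: (x i) => /=; ring.
  rewrite sumrB sumr_const card_ord -mulr_sumr; congr (2 * _ - _).
  rewrite -sum1_card natr_sum big_mkcond [in RHS]big_mkcond /=.
  by apply: eq_bigr => i _; rewrite inE; case: (x i).
by field.
Qed.

Lemma card_plus_count (N k : nat) : #|[pred x : cube N | plus_count x == k]| = 'C(N, k).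
Proof.
rewrite -[in RHS](card_ord N) -card_draws -!sum1_card.
rewrite (reindex (fun x : cube N => [set i | x i]%SET)) /=.
  by apply: eq_bigl => x; rewrite !inE.
exists (fun A : {set 'I_N} => [ffun i => i \in A]) => [x|A] _.
  by apply/ffunP => i; rewrite ffunE inE.
by apply/setP => i; rewrite inE ffunE.
Qed.

Definition level_weight (R : realType) (beta h : R) (p N k : nat) : R :=
  \sum_(x : cube N | plus_count x == k) cw_weight beta h p x.

Lemma cw_weight_ge0 (R : realType) (beta h : R) p N (x : cube N) :
  0 <= cw_weight beta h p x.
Proof. exact: expR_ge0. Qed.

Lemma level_weight_ge0 (R : realType) (beta h : R) p N k :
  0 <= level_weight beta h p N k.
Proof. by apply: sumr_ge0 => x _; exact: cw_weight_ge0. Qed.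

Lemma level_weightE (R : realType) (beta h : R) p N k : (0 < N)%N ->
  level_weight beta h p N k =
  'C(N, k)%:R * expR (N%:R * energy beta h p (level_magnetization R N k)).
Proof.
move=> N0; rewrite /level_weight -card_plus_count -sum1_card natr_sum mulr_suml.
by apply: eq_bigr => x /eqP <-; rewrite mul1r /cw_weight magnetization_plus_count.
Qed.

Lemma levelS (R : realType) N k : (0 < N)%N ->
  level_magnetization R N k.+1 = level_magnetization R N k + 2 / N%:R.
Proof.
move=> N0; have NR : N%:R != 0 :> R by rewrite pnatr_eq0 -lt0n.
by rewrite /level_magnetization -natr1; field.
Qed.

Lemma level_ltn (R : realType) N k :
  (0 < N)%N -> level_magnetization R N k < 1 -> (k < N)%N.
Proof.
move=> N0; rewrite /level_magnetization ltrBlDr ltr_pdivrMr ?ltr0n // => H.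
by rewrite -(ltr_nat R); lra.
Qed.

(** The quotient of consecutive binomial coefficients is
    (N - k) / (k + 1) = (1 - x) / (1 + x'). *)
Lemma level_weight_ratio (R : realType) (beta h : R) p N k : (k < N)%N ->
  let x := level_magnetization R N k in let x' := level_magnetization R N k.+1 in
  level_weight beta h p N k.+1 = level_weight beta h p N k *
    ((1 - x) / (1 + x') * expR (N%:R * (energy beta h p x' - energy beta h p x))).
Proof.
move=> kN x x'; have N0 : (0 < N)%N by apply: leq_ltn_trans kN.
have NR : 0 < N%:R :> R by rewrite ltr0n.
rewrite !level_weightE // -/x -/x' mulrBr expRD expRN.
have binS : (k%:R + 1) * 'C(N, k.+1)%:R = (N%:R - k%:R) * 'C(N, k)%:R :> R.
  by rewrite natr1 -natrB ?(ltnW kN) // -!natrM mul_bin_left.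
have k0 : 0 <= k%:R :> R by rewrite ler0n.
have -> : 'C(N, k.+1)%:R = 'C(N, k)%:R * ((1 - x) / (1 + x')) :> R.
  have E1 : 1 - x = 2 * (N%:R - k%:R) / N%:R.
    by rewrite /x /level_magnetization; field; rewrite gt_eqF.
  have E2 : 1 + x' = 2 * (k%:R + 1) / N%:R.
    by rewrite /x' /level_magnetization -natr1; field; rewrite gt_eqF.
  have k1 : k%:R + 1 != 0 :> R by rewrite gt_eqF //; lra.
  apply: (mulfI k1); rewrite binS E1 E2; field.
  by rewrite !gt_eqF //; lra.
field; rewrite !gt_eqF ?expR_gt0 // /x' /level_magnetization -natr1 addrC subrK.
by rewrite divr_gt0 //; lra.
Qed.

Lemma ratio_ge_num (R : realType) (kappa g a b : R) : 0 < kappa <= a -> 0 < b ->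
  0 <= g -> b <= a + g -> 1 - g / kappa <= a / b.
Proof.
move=> /andP[k0 ka] b0 g0 bag; rewrite ler_pdivlMr //.
have -> : (1 - g / kappa) * b = (kappa - g) * b / kappa by field; rewrite gt_eqF.
rewrite ler_pdivrMr //.
have [gk|/ltW kg] := leP kappa g; first by nra.
apply: (@le_trans _ _ ((kappa - g) * (a + g))).
  by rewrite ler_wpM2l // subr_ge0.
by nra.
Qed.

Lemma ratio_ge_den (R : realType) (kappa g a b : R) : 0 < kappa <= b ->
  0 <= g -> b - g <= a -> 1 - g / kappa <= a / b.
Proof.
move=> /andP[k0 kb] g0 bga; have b0 : 0 < b by apply: lt_le_trans kb.
rewrite ler_pdivlMr //; apply: le_trans bga.
rewrite mulrBl mul1r lerB // mulrAC ler_pdivlMr //.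
by rewrite ler_wpM2l.
Qed.

(** If a or b exceeds 1 then the left-hand side is nonpositive; otherwise
    1 - (a + b) <= (1 - a) (1 - b). *)
Lemma mul_ge_1sub (R : realType) (a b x y : R) : 0 <= a -> 0 <= b ->
  0 <= x -> 0 <= y -> 1 - a <= x -> 1 - b <= y -> 1 - (a + b) <= x * y.
Proof.
move=> a0 b0 x0 y0 ax by_.
have xy : 0 <= x * y by rewrite mulr_ge0.
have [a1|/ltW a1] := leP 1 a; first by lra.
have [b1|/ltW b1] := leP 1 b; first by lra.
apply: (@le_trans _ _ ((1 - a) * (1 - b))); first by nra.
by apply: ler_pM => //; lra.
Qed.

(** By the Taylor expansion of the energy and the formula for exp (2 u), the
    ratio of consecutive level weights is
    (1 - x) / (1 - T) * (1 + T) / (1 + x') up to a factor 1 - O(1/N),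
    where T = tanh (u x). The product (1 - x) / (1 - T) * (1 + T) / (1 + x')
    is close to 1 because |T - x| = O(s^-2) by the drift bound, and
    x' - x = 2/N. *)
Lemma level_weight_slow (R : realType) (beta h : R) p (m : R) :
  degenerate beta h p m ->
  exists a s0 : R, [/\ 1 <= a, 2 <= s0 & forall N k (s : R),
    s0 <= s -> s ^+ 3 = N%:R -> `|level_magnetization R N k - m| <= 4 / s ->
    (1 - a / s ^+ 2) * level_weight beta h p N k
      <= level_weight beta h p N k.+1].
Proof.
move=> dg; have [C C0 drift] := drift_quadratic dg.
have [/andP[m1 m2] _ _] := dg.
(* Half the distance from m to the nearest endpoint of [-1, 1]: the levels
   considered stay kappa away from them once s >= 6 / kappa. *)
pose kappa := (1 - `|m|) / 2.
have m01 : `|m| < 1 by rewrite ltr_norml m1.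
have kappa0 : 0 < kappa by rewrite /kappa; lra.
have kappa1 : kappa <= 1 / 2 by rewrite /kappa; have := normr_ge0 m; lra.
pose K := `|p%:R * beta * p.-1%:R|.
have K0 : 0 <= K by exact: normr_ge0.
pose a := 1 + ((16 * C) / kappa + (16 * C + 2) / kappa + 4 * K).
have a1 : 1 <= a.
  have t1 : 0 <= 16 * C / kappa by apply: divr_ge0; lra.
  have t2 : 0 <= (16 * C + 2) / kappa by apply: divr_ge0; lra.
  by rewrite /a; lra.
exists a, (6 / kappa); split=> // [|N k s s0 sN].
  by rewrite ler_pdivlMr //; lra.
have sk : 6 <= s * kappa by rewrite -ler_pdivrMr.
have s12 : 12 <= s by nra.
have sp : 0 < s by lra.
have NR : 0 < N%:R :> R by rewrite -sN exprn_gt0.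
have N0 : (0 < N)%N by rewrite -(ltr0n R).
have sinv : 6 / s <= kappa by rewrite ler_pdivrMr // mulrC.
have N2 : 1 / N%:R <= 1 / s ^+ 2.
  rewrite -sN !div1r lef_pV2 ?posrE ?exprn_gt0 // ler_weXn2l //; lra.
have N1 : 1 / N%:R <= 1 / s.
  by apply: le_trans N2 _; rewrite !div1r lef_pV2 ?posrE ?exprn_gt0 // ler_eXnr //; lra.
set x := level_magnetization R N k => xm.
have xS : level_magnetization R N k.+1 = x + 2 / N%:R by exact: levelS.
have Ninv : 0 < 1 / N%:R :> R by rewrite divr_gt0.
have [xlo xhi] : kappa <= 1 - x - 2 / N%:R /\ kappa <= 1 + x.
  move: xm; rewrite ler_norml => /andP[xm1 xm2].
  have := ler_norm m; have := ler_norm (- m); rewrite normrN.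
  by move: sinv; rewrite /kappa; split; lra.
have ox0 : 0 <= 1 - x by lra.
have ix0 : 0 <= 1 + (x + 2 / N%:R) by lra.
have x1 : `|x| <= 1 by rewrite ler_norml; lra.
have x'1 : `|x + 2 / N%:R| <= 1 by rewrite ler_norml; lra.
have kN : (k < N)%N by apply: (@level_ltn R) => //; rewrite -/x; lra.
rewrite level_weight_ratio // xS -/x mulrC ler_wpM2l ?level_weight_ge0 //.
set u := local_field beta h p x.
set T := tanh u; have /andP[T1 T2] : -1 < T < 1 := tanh_bounds u.
have oT0 : 0 <= 1 - T by lra.
have iT0 : 0 <= 1 + T by lra.
pose g := 16 * C / s ^+ 2.
have g0 : 0 <= g by rewrite divr_ge0 ?mulr_ge0 ?exprn_ge0 // ltW.
have Tx : `|T - x| <= g.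
  apply: le_trans (drift _ x1) _.
  have -> : g = C * (4 / s) ^+ 2 by rewrite /g; field; rewrite gt_eqF.
  rewrite ler_wpM2l // -(real_normK (num_real (x - m))) lerXn2r ?nnegrE //.
  by rewrite divr_ge0 // ltW.
have /andP[Tx1 Tx2] : - g <= T - x <= g by rewrite -ler_norml.
pose Z := expR (- (4 * K / N%:R)).
have Z1 : 1 - 4 * K / s ^+ 2 <= Z.
  apply: le_trans (expR_ge1Dx _); rewrite lerD2l lerN2.
  by move: N2; rewrite !div1r => N2; rewrite ler_wpM2l // mulr_ge0.
have expE : (1 + T) / (1 - T) * Z <=
    expR (N%:R * (energy beta h p (x + 2 / N%:R) - energy beta h p x)).
  have tay := energy_taylor beta h p x1 x'1.
  rewrite -/K -/u in tay.
  rewrite -expR_tanh -expRD ler_expR.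
  have -> : 2 * u + - (4 * K / N%:R) =
      N%:R * (u * (2 / N%:R) - K * (2 / N%:R) ^+ 2) by field; rewrite gt_eqF.
  rewrite ler_wpM2l ?ler0n //.
  move: tay; have -> : x + 2 / N%:R - x = 2 / N%:R by ring.
  by rewrite ler_norml => /andP[tay _]; lra.
apply: (@le_trans _ _ ((1 - x) / (1 + (x + 2 / N%:R)) * ((1 + T) / (1 - T) * Z)));
  last first.
  by rewrite ler_wpM2l // divr_ge0.
have -> : (1 - x) / (1 + (x + 2 / N%:R)) * ((1 + T) / (1 - T) * Z) =
  (1 - x) / (1 - T) * ((1 + T) / (1 + (x + 2 / N%:R))) * Z.
  by rewrite -!mulrA; congr (_ * _); rewrite [LHS]mulrCA [RHS]mulrCA [X in _ * X]mulrCA.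
have s2inv : 0 <= 1 / s ^+ 2 by rewrite divr_ge0 // exprn_ge0 // ltW.
have s2inv2 : 0 <= 2 / s ^+ 2 by rewrite divr_ge0 // exprn_ge0 // ltW.
have X1 : 1 - g / kappa <= (1 - x) / (1 - T).
  apply: ratio_ge_num => //; first by rewrite kappa0 /=; lra.
    by rewrite subr_gt0.
  by lra.
have Y1 : 1 - (g + 2 / s ^+ 2) / kappa <= (1 + T) / (1 + (x + 2 / N%:R)).
  by apply: ratio_ge_den; rewrite ?(addr_ge0 g0) // ?kappa0 /=; lra.
apply: (@le_trans _ _ (1 - (g / kappa + (g + 2 / s ^+ 2) / kappa + 4 * K / s ^+ 2))).
  have -> : a / s ^+ 2 =
    1 / s ^+ 2 + (g / kappa + (g + 2 / s ^+ 2) / kappa + 4 * K / s ^+ 2).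
    by rewrite /a /g; field; rewrite !gt_eqF.
  by rewrite lerD2l lerN2 lerDr.
have e1 : 0 <= g / kappa by rewrite divr_ge0 // ltW.
have e2 : 0 <= (g + 2 / s ^+ 2) / kappa by rewrite divr_ge0 ?(addr_ge0 g0) // ltW.
have e3 : 0 <= 4 * K / s ^+ 2.
  by apply: divr_ge0; [rewrite mulr_ge0|rewrite exprn_ge0 // ltW].
have r1 : 0 <= (1 - x) / (1 - T) by rewrite divr_ge0.
have r2 : 0 <= (1 + T) / (1 + (x + 2 / N%:R)) by rewrite divr_ge0.
have Z0 : 0 <= Z by exact: expR_ge0.
apply: (mul_ge_1sub (addr_ge0 e1 e2) e3 (mulr_ge0 r1 r2) Z0 _ Z1).
exact: (mul_ge_1sub e1 e2 r1 r2 X1 Y1).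
Qed.

(** * Gibbs mass of the window *)

(** Bernoulli's inequality along consecutive levels; j <= s^2 steps change
    the magnetization by at most 2 / s, which keeps the levels in the range
    of the hypothesis. *)
Lemma level_weight_persist (R : realType) (beta h : R) p (m a s0 : R) :
  (forall N k (s : R), s0 <= s -> s ^+ 3 = N%:R ->
    `|level_magnetization R N k - m| <= 4 / s ->
    (1 - a / s ^+ 2) * level_weight beta h p N k
      <= level_weight beta h p N k.+1) ->
  forall N k j (s : R), 0 <= a <= s ^+ 2 -> 1 <= s -> s0 <= s -> s ^+ 3 = N%:R ->
    `|level_magnetization R N k - m| <= 2 / s -> j%:R <= s ^+ 2 ->
    (1 - j%:R * (a / s ^+ 2)) * level_weight beta h p N k
      <= level_weight beta h p N (k + j).
Proof.
move=> slow N k j s /andP[a0 as2] s1 s0s sN km.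
have sp : 0 < s by lra.
have s2p : 0 < s ^+ 2 by rewrite exprn_gt0.
have N0 : (0 < N)%N by rewrite -(ltr0n R) -sN exprn_gt0.
elim: j => [|j IH] js; first by rewrite mul0r subr0 mul1r addn0.
have js' : j%:R <= s ^+ 2 by apply: le_trans js; rewrite ler_nat.
set b := a / s ^+ 2 in IH *.
have b0 : 0 <= b by rewrite divr_ge0 // ltW.
have b1 : b <= 1 by rewrite ler_pdivrMr // mul1r.
have kj : `|level_magnetization R N (k + j) - m| <= 4 / s.
  have -> : level_magnetization R N (k + j) - m =
      (level_magnetization R N k - m) + 2 * j%:R / s ^+ 3.
    by rewrite /level_magnetization natrD sN; field; rewrite pnatr_eq0 -lt0n.
  apply: le_trans (ler_normD _ _) _.
  have -> : 4 / s = 2 / s + 2 / s by lra.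
  apply: lerD => //; rewrite ger0_norm; last first.
    by apply: divr_ge0; [rewrite mulr_ge0|rewrite exprn_ge0 // ltW].
  have -> : 2 / s = 2 * s ^+ 2 / s ^+ 3 by field; rewrite gt_eqF.
  by rewrite ler_pM2r ?invr_gt0 ?exprn_gt0 // ler_pM2l.
rewrite addnS; apply: le_trans (slow _ _ _ s0s sN kj); rewrite -/b.
apply: (@le_trans _ _ ((1 - b) * ((1 - j%:R * b) * level_weight beta h p N k))).
  rewrite mulrA ler_wpM2r ?level_weight_ge0 // -natr1.
  have : 0 <= j%:R * b * b by apply: mulr_ge0 => //; apply: mulr_ge0 => //; exact: ler0n.
  by lra.
by rewrite ler_wpM2l ?subr_ge0 // IH.
Qed.

Lemma sum_levels_le (R : realType) (beta h : R) p N k n :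
  \sum_(j < n) level_weight beta h p N (k + j) <=
  \sum_(x : cube N) cw_weight beta h p x.
Proof.
rewrite /level_weight.
under eq_bigr do rewrite big_mkcond /=.
rewrite exchange_big /=; apply: ler_sum => x _.
rewrite -big_mkcond /=.
have [/existsP[j /eqP xj]|none] := boolP [exists j : 'I_n, plus_count x == (k + j)%N].
  rewrite (big_pred1 j) // => i /=.
  by rewrite xj eqn_add2l eq_sym.
rewrite big_pred0 ?cw_weight_ge0 // => j.
by apply/negbTE; move: none => /existsPn.
Qed.

(** About s^2 / (2 a) levels following k have at least half its weight, and
    together they weigh at most the total. *)
Lemma level_weight_le (R : realType) (beta h : R) p (m a s0 : R) :
  1 <= a ->
  (forall N k (s : R), s0 <= s -> s ^+ 3 = N%:R ->
    `|level_magnetization R N k - m| <= 4 / s ->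
    (1 - a / s ^+ 2) * level_weight beta h p N k
      <= level_weight beta h p N k.+1) ->
  forall N k (s : R), 4 * a <= s ^+ 2 -> 1 <= s -> s0 <= s -> s ^+ 3 = N%:R ->
    `|level_magnetization R N k - m| <= 2 / s ->
    level_weight beta h p N k <=
      8 * a / s ^+ 2 * \sum_(x : cube N) cw_weight beta h p x.
Proof.
move=> a1 slow N k s as2 s1 s0s sN km.
have persist j := level_weight_persist slow (N := N) (k := k) (j := j) (s := s).
set W := level_weight beta h p N k.
set Z := \sum_(x : cube N) _.
have sp : 0 < s by lra.
have s2p : 0 < s ^+ 2 by rewrite exprn_gt0.
have a0 : 0 < a by lra.
have W0 : 0 <= W by exact: level_weight_ge0.
(* The bound a / s^2 on the loss per level leaves half of the weight after
   v levels. *)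
pose v := s ^+ 2 / (2 * a).
have v0 : 0 <= v by rewrite divr_ge0 ?mulr_ge0 // ltW.
have v2 : 2 <= v by rewrite ler_pdivlMr //; lra.
have /andP[M1 M2] := truncn_itv v0; set M := Num.trunc v in M1 M2.
rewrite -natr1 in M2.
have half : M%:R * (2^-1 * W) <= Z.
  apply: le_trans (sum_levels_le beta h p N k M).
  rewrite -[M in M%:R]card_ord mulr_natl -sumr_const; apply: ler_sum => j _.
  have jM : j%:R <= v by apply: le_trans M1; rewrite ler_nat ltnW.
  have jb : j%:R * (a / s ^+ 2) <= 2^-1.
    rewrite mulrA ler_pdivrMr //.
    by move: jM; rewrite ler_pdivlMr //; lra.
  apply: le_trans (persist j _ s1 s0s sN km _).
  - by rewrite ler_wpM2r // -/W; lra.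
  - by apply/andP; split; lra.
  - by apply: le_trans jM _; rewrite ler_pdivrMr ?mulr_gt0 // ler_peMr; lra.
have vM : v / 2 <= M%:R by lra.
have : v / 2 * (2^-1 * W) <= Z.
  by apply: le_trans half; rewrite ler_wpM2r // mulr_ge0.
have -> : v / 2 * (2^-1 * W) = s ^+ 2 / (8 * a) * W.
  by rewrite /v; field; rewrite gt_eqF.
rewrite -ler_pdivlMl ?divr_gt0 ?mulr_gt0 // invf_div => H.
exact: H.
Qed.

(** The window is covered by the levels k0, ..., k0 + n + 1 where k0 is its
    left end and n the integer part of d s^2. *)
Lemma gibbs_window (R : realType) (beta h : R) p (m : R) :
  degenerate beta h p m ->
  exists a s0 : R, [/\ 1 <= a, 1 <= s0 & forall N (s d : R),
    s0 <= s -> s ^+ 3 = N%:R -> 0 < d <= 1 ->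
    \sum_(x in [set x : cube N | `|s * (magnetization R x - m)| <= d]%SET)
      curie_weiss beta h p x <= 8 * a * d + 16 * a / s ^+ 2].
Proof.
move=> dg; have [a [s0 [a1 s02 slow]]] := level_weight_slow dg.
have [/andP[m1 m2] _ _] := dg.
exists a, (s0 + 4 * a + (1 + m)^-1); split=> //.
  have : 0 <= (1 + m)^-1 by rewrite invr_ge0; lra.
  by lra.
move=> N s d ss sN /andP[d0 d1].
have im : 0 < (1 + m)^-1 by rewrite invr_gt0; lra.
have s0s : s0 <= s by lra.
have s1 : 4 <= s by lra.
have sp : 0 < s by lra.
have as2 : 4 * a <= s ^+ 2 by nra.
have s2p : 0 < s ^+ 2 by rewrite exprn_gt0.
have NR : 0 < N%:R :> R by rewrite -sN exprn_gt0.
have N0 : (0 < N)%N by rewrite -(ltr0n R).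
have sinv : s^-1 <= 1 + m.
  by rewrite -[1 + m]invrK lef_pV2 ?posrE //; lra.
set A := finset _; set Z := \sum_(x : cube N) cw_weight beta h p x.
have Z0 : 0 < Z.
  have x0 : cube N by exact: [ffun => true].
  apply: (@lt_le_trans _ _ (cw_weight beta h p x0)); first exact: expR_gt0.
  rewrite /Z (bigD1 x0) //= lerDl.
  by apply: sumr_ge0 => x _; exact: cw_weight_ge0.
rewrite /curie_weiss -mulr_suml ler_pdivrMr // -/Z.
(* v is the possibly fractional number of plus spins at the left end. *)
pose v := N%:R * (1 + m - d / s) / 2.
have v0 : 0 <= v.
  rewrite divr_ge0 ?mulr_ge0 ?ler0n // subr_ge0; apply: le_trans sinv.
  by rewrite ler_piMl ?invr_ge0 // ltW.
have w0 : 0 <= d * s ^+ 2 by rewrite mulr_ge0 // ltW.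
have /andP[k1 k2] := truncn_itv v0; set k0 := Num.trunc v in k1 k2.
have /andP[n1 n2] := truncn_itv w0; set n := Num.trunc _ in n1 n2.
rewrite -natr1 in k2; rewrite -natr1 in n2.
have vE : v = (s ^+ 3 * (1 + m) - d * s ^+ 2) / 2.
  by rewrite /v -sN; field; rewrite gt_eqF.
apply: (@le_trans _ _ (\sum_(i < n.+2) level_weight beta h p N (k0 + i))).
  rewrite /level_weight; under [leRHS]eq_bigr do rewrite big_mkcond /=.
  rewrite exchange_big /= [leLHS]big_mkcond /=; apply: ler_sum => x _.
  have w : 0 <= cw_weight beta h p x by exact: cw_weight_ge0.
  case: ifP => [|_]; last by apply: sumr_ge0 => i _; case: ifP.
  rewrite inE magnetization_plus_count // ler_norml => /andP[x1 x2].
  have lE : s * (level_magnetization R N (plus_count x) - m) * s ^+ 2 =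
      2 * (plus_count x)%:R - s ^+ 3 * (1 + m).
    by rewrite /level_magnetization -sN; field; rewrite gt_eqF.
  have x1' : - d * s ^+ 2 <= 2 * (plus_count x)%:R - s ^+ 3 * (1 + m).
    by rewrite -lE ler_wpM2r // ltW.
  have x2' : 2 * (plus_count x)%:R - s ^+ 3 * (1 + m) <= d * s ^+ 2.
    by rewrite -lE ler_wpM2r // ltW.
  have kx : (k0 <= plus_count x)%N.
    by rewrite -(ler_nat R); apply: le_trans k1 _; rewrite vE; lra.
  have xk : (plus_count x - k0 < n.+2)%N.
    rewrite ltn_subLR // -(ltr_nat R) natrD -addn2 natrD.
    by move: k2; rewrite vE; lra.
  rewrite (bigD1 (Ordinal xk)) //= subnKC // eqxx lerDl.
  by apply: sumr_ge0 => i _; case: ifP.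
have lvl (i : 'I_n.+2) : level_weight beta h p N (k0 + i) <= 8 * a / s ^+ 2 * Z.
  apply: (level_weight_le a1 slow) => //; first lra.
  have lE : (level_magnetization R N (k0 + i) - m) * s ^+ 3 =
      2 * (k0%:R + i%:R) - s ^+ 3 * (1 + m).
    by rewrite /level_magnetization -sN natrD; field; rewrite gt_eqF.
  have i0 : 0 <= i%:R :> R by rewrite ler0n.
  have i1 : i%:R <= n%:R + 1 :> R by rewrite natr1 ler_nat -ltnS.
  have ds : d * s ^+ 2 <= s ^+ 2 by rewrite ler_piMl // ltW.
  have s2 : 4 <= s ^+ 2 by nra.
  have -> : 2 / s = 2 * s ^+ 2 / s ^+ 3 by field; rewrite gt_eqF.
  rewrite ler_pdivlMr ?exprn_gt0 //.
  have s30 : 0 <= s ^+ 3 by rewrite sN ler0n.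
  rewrite -[s ^+ 3 in leLHS](ger0_norm s30) -normrM lE ler_norml.
  by move: k1 k2; rewrite vE => k1 k2; apply/andP; split; lra.
apply: le_trans (ler_sum _ (fun i _ => lvl i)) _.
rewrite sumr_const card_ord -[_ *+ _]mulr_natl mulrA ler_wpM2r //; first exact: ltW.
have -> : 8 * a * d + 16 * a / s ^+ 2 = (d * s ^+ 2 + 2) * (8 * a / s ^+ 2).
  by field; rewrite gt_eqF.
apply: ler_wpM2r; first by rewrite divr_ge0 // ?mulr_ge0 //; lra.
by rewrite -addn2 natrD; lra.
Qed.

(** * Total variation distance and mixing time *)

Lemma dTV_ge (R : realType) (T : finType) (mu nu : T -> R) (A : {set T}) :
  \sum_(x in A) mu x - \sum_(x in A) nu x <= dTV mu nu.
Proof.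
apply: le_trans (ler_norm _) _.
exact: (le_bigmax 0 (fun A : {set T} => `|\sum_(x in A) mu x - \sum_(x in A) nu x|)).
Qed.

(** The witness has k spins equal to +1, where k is the integer part of
    N (1 + m) / 2. *)
Lemma magnetization_near (R : realType) (N : nat) (m : R) : (0 < N)%N -> -1 < m < 1 ->
  exists x : cube N, `|magnetization R x - m| <= 2 / N%:R.
Proof.
move=> N0 /andP[m1 m2]; have NR : 0 < N%:R :> R by rewrite ltr0n.
pose v := N%:R * (1 + m) / 2.
have v0 : 0 <= v by rewrite divr_ge0 ?mulr_ge0 ?ler0n //; lra.
have /andP[k1 k2] := truncn_itv v0; set k := Num.trunc v in k1 k2.
have kN : (k <= N)%N.
  by rewrite -(ler_nat R); apply: le_trans k1 _; rewrite /v; nra.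
have : (0 < #|[pred x : cube N | plus_count x == k]|)%N by rewrite card_plus_count bin_gt0.
move=> /card_gt0P[x]; rewrite inE => /eqP xk; exists x.
rewrite magnetization_plus_count // xk.
have -> : level_magnetization R N k - m = 2 * (k%:R - v) / N%:R.
  by rewrite /level_magnetization /v; field; rewrite gt_eqF.
rewrite normrM [`|_^-1|]ger0_norm ?invr_ge0 ?ler0n // ler_pM2r ?invr_gt0 //.
by rewrite -natr1 in k2; rewrite ler_norml; apply/andP; split; lra.
Qed.

(** Both errors, the probability that the chain leaves the window and the
    Gibbs mass of the window, are made at most eta = (1 - eps) / 3, and
    1 - 2 eta > eps. *)
Lemma glauber_dTV_gt (R : realType) (p : nat) (eps beta h m : R) : 0 < eps < 1 ->
  degenerate beta h p m ->
  exists c s0 : R, [/\ 0 < c, 1 <= s0 & forall N t (s : R),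
    s0 <= s -> s ^+ 3 = N%:R -> t%:R < c * s ^+ 4 ->
    exists x : cube N, eps < dTV (glauber_law beta h p x t) (@curie_weiss R beta h p N)].
Proof.
move=> /andP[e0 e1] dg.
have [K K0 stay] := glauber_law_confined dg.
have [a [s0 [a1 s01 window]]] := gibbs_window dg.
have [m1 _ _] := dg.
pose eta := (1 - eps) / 3.
have eta0 : 0 < eta by rewrite /eta; lra.
have eta1 : eta <= 1 by rewrite /eta; lra.
(* Each of the two terms in the bound on the Gibbs mass, 8 a d and
   16 a / s^2, is to be at most eta / 2. *)
pose d := eta / (16 * a).
have d0 : 0 < d by rewrite divr_gt0 // mulr_gt0 //; lra.
have d1 : d <= 1 by rewrite ler_pdivrMr ?mul1r //; lra.
pose q := psi d.
have q0 : 0 < q by rewrite /q /psi divr_gt0 ?exprn_gt0 // ltr_pwDl ?sqr_ge0.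
(* In the confinement bound, the initial term and the growth over t < c s^4
   steps are to be at most q eta / 2 each. *)
pose c := q * eta / (2 * K).
have c0 : 0 < c by apply: divr_gt0; exact: mulr_gt0.
have sa0 : 0 < 32 * a / eta by rewrite divr_gt0 // mulr_gt0 //; lra.
have sq0 : 0 < 8 / (q * eta) by rewrite divr_gt0 // mulr_gt0.
exists c, (s0 + 32 * a / eta + 8 / (q * eta)); split=> //; first by lra.
move=> N t s ss sN tc.
have s0s : s0 <= s by lra.
have s1 : 1 <= s by lra.
have sp : 0 < s by lra.
have N0 : (0 < N)%N by rewrite -(ltr0n R) -sN exprn_gt0.
have [x xm] := magnetization_near N0 m1; exists x.
have s4 : 0 < s ^+ 4 by rewrite exprn_gt0.
have start : psi (s * (magnetization R x - m)) <= 4 / s ^+ 4.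
  apply: le_trans (psi_le_sqr _) _.
  have -> : 4 / s ^+ 4 = (s * (2 / N%:R)) ^+ 2 by rewrite -sN; field; rewrite gt_eqF.
  rewrite -[leLHS](real_normK (num_real _)) normrM (ger0_norm (ltW sp)).
  by rewrite lerXn2r ?nnegrE ?mulr_ge0 ?divr_ge0 ?(ltW sp) // ler_pM2l.
have := stay N x s d t s1 sN d0.
have := window N s d s0s sN; rewrite d0 d1 => /(_ isT).
set A := finset _ => piA lawA.
apply: lt_le_trans (dTV_ge _ _ A).
have piA' : 8 * a * d + 16 * a / s ^+ 2 <= eta.
  have -> : 8 * a * d = eta / 2 by rewrite /d; field; rewrite gt_eqF //; lra.
  have : 16 * a / s ^+ 2 <= eta / 2.
    rewrite ler_pdivrMr ?exprn_gt0 //.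
    have : 32 * a / eta <= s by lra.
    by rewrite ler_pdivrMr // => H; nra.
  by lra.
have lawA' : (psi (s * (magnetization R x - m)) + t%:R * (K / s ^+ 4)) / psi d <= eta.
  rewrite ler_pdivrMr // -/q.
  have h1 : 4 / s ^+ 4 <= q * eta / 2.
    rewrite ler_pdivrMr //.
    have : 8 / (q * eta) <= s by lra.
    have qe0 := mulr_gt0 q0 eta0.
    rewrite ler_pdivrMr // => H.
    have s14 : s <= s ^+ 4 by rewrite ler_eXnr.
    have : s * (q * eta) <= s ^+ 4 * (q * eta) by rewrite ler_pM2r.
    by lra.
  have h2 : t%:R * (K / s ^+ 4) <= q * eta / 2.
    have -> : q * eta / 2 = c * s ^+ 4 * (K / s ^+ 4).
      by rewrite /c; field; rewrite !gt_eqF.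
    by rewrite ler_wpM2r ?divr_ge0 // ltW.
  by lra.
by move: eta0 piA lawA piA' lawA'; rewrite /eta; lra.
Qed.

Theorem propositionD1 (R : realType) (p : nat) (eps beta h : R)
    (hp : (3 <= p)%N) (heps : 0 < eps < 1) (hB : frakB p (beta, h)) :
  exists2 c : R, 0 < c &
    \forall N \near \oo,
      ((c * N%:R `^ (4 / 3))%:E <= mixing_time beta h p N eps)%E.
Proof.
have [m dg] := frakB_degenerate hp hB.
have [c [s0 [c0 s01 far]]] := glauber_dTV_gt heps dg.
exists c => //; near=> N.
pose s : R := N%:R `^ (3^-1).
have N0 : 0 <= N%:R :> R by exact: ler0n.
have sE k : N%:R `^ (k%:R / 3) = s ^+ k.
  by rewrite -powR_mulrn ?powR_ge0 // -powRrM mulrC.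
have sN : s ^+ 3 = N%:R by rewrite -sE divff ?pnatr_eq0 // powRr1.
have s0s : s0 <= s.
  have s0N : s0 ^+ 3 <= N%:R by near: N; exact: nbhs_infty_ger.
  rewrite leNgt; apply/negP => ss0.
  have : s ^+ 3 < s0 ^+ 3 by rewrite ltrXn2r ?nnegrE ?powR_ge0 //; lra.
  by rewrite sN ltNge s0N.
rewrite sE; apply: le_ereal_inf_tmp => _ [t mix <-]; rewrite lee_fin leNgt.
apply/negP => tc; have [x] := far N t s s0s sN tc; apply/negP; rewrite -leNgt.
apply: le_trans mix.
exact: (le_bigmax 0 (fun x => dTV (glauber_law beta h p x t) (@curie_weiss R beta h p N))).
Unshelve. all: by end_near. Qed.
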